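(* Let $\mathbf{L}$ and $\mathbf{M}$ be calculi on a set $S$, and let $\ell,\mathfrak r\colon S^*\to S^*$ be functions such that $(\ell,\mathfrak r)$ is a sound and faithful translation from $\mathbf{M}$ to $\mathbf{M}$. Define $\mathbf{G}:=\mathbf{L}\cup\mathbf{M}_{(\ell,\mathfrak r)}$. Then: (1) (Soundness) $(\ell,\mathfrak r)$ is a sound translation from $\mathbf{M}$ to $\mathbf{G}$. Moreover, $(\ell,\mathfrak r)$ is a sound translation from $\mathbf{M}$ to $\mathbf{K}$ for every calculus $\mathbf{K}$ on $S$ with $\mathbf{G}\preceq\mathbf{K}$. (2) (Faithfulness) $(\ell,\mathfrak r)$ is a faithful translation from $\mathbf{M}$ to $\mathbf{K}$ for every calculus $\mathbf{K}$ on $S$ with $\mathbf{K}\preceq\mathbf{M}$. In particular, this holds for $\mathbf{K}=\mathbf{L}$ and for $\mathbf{K}=\mathbf{G}$. (3) (Minimality) If $\mathbf{K}$ is a calculus on $S$ such that $\mathbf{L}\preceq\mathbf{K}$ and $(\ell,\mathfrak r)$ is a sound and faithful translation from $\mathbf{M}$ to $\mathbf{K}$, then $\mathbf{G}\preceq\mathbf{K}$.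
   Context: For a set $S$, $S^*$ is the set of finite lists over $S$; a sequent over $S$ is a pair $(\Gamma,\Delta)\in S^*\times S^*$, written $\Gamma\Rightarrow\Delta$. A rule on $S$ is a rule schema with premisses $\{\Gamma_i\Rightarrow\Delta_i : i\in I\}$, $I\subseteq\mathbb N$, and conclusion $\Gamma\Rightarrow\Delta$, possibly containing metavariables ranging over elements of $S$ and over lists in $S^*$; its instances are obtained by simultaneously substituting the metavariables. A calculus on $S$ is a set of rules on $S$. An $\mathbf{L}$-derivation is a finite well-founded proof tree whose nodes are sequents and whose every inference is an instance of a rule of $\mathbf{L}$; $\mathbf{L}\vdash\Gamma\Rightarrow\Delta$ means that there is an $\mathbf{L}$-derivation with conclusion $\Gamma\Rightarrow\Delta$. A rule is admissible in $\mathbf{L}$ if, for each of its instances, whenever all premisses are derivable in $\mathbf{L}$, so is the conclusion. $\mathbf{L}\preceq\mathbf{M}$ means that every rule of $\mathbf{L}$ is admissible in $\mathbf{M}$. For functions $\ell,\mathfrak r\colon S^*\to S^*$ and a rule $\sigma$ with premisses $\Gamma_i\Rightarrow\Delta_i$ ($i\in I$) and conclusion $\Gamma\Rightarrow\Delta$, the rule $\sigma_{(\ell,\mathfrak r)}$ has premisses $\ell(\Gamma_i)\Rightarrow\mathfrak r(\Delta_i)$ ($i\in I$) and conclusion $\ell(\Gamma)\Rightarrow\mathfrak r(\Delta)$ (its instances are the images of the instances of $\sigma$). Put $\mathbf{M}_{(\ell,\mathfrak r)}:=\{\sigma_{(\ell,\mathfrak r)}:\sigma\in\mathbf{M}\}$.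 The pair $(\ell,\mathfrak r)$ is a sound translation from $\mathbf{M}$ to $\mathbf{L}$ if for all sequents, $\mathbf{M}\vdash\Gamma\Rightarrow\Delta$ implies $\mathbf{L}\vdash\ell(\Gamma)\Rightarrow\mathfrak r(\Delta)$; it is a faithful translation if for all sequents, $\mathbf{L}\vdash\ell(\Gamma)\Rightarrow\mathfrak r(\Delta)$ implies $\mathbf{M}\vdash\Gamma\Rightarrow\Delta$.
   Formalization: In (2), the ''in particular'' for K = L and K = G is stated under the added assumption L ⪯ M (without it the claim is false); derivations are well-founded trees, infinitely branching when a rule has infinitely many premisses, and finite when all premiss sets are finite. *)

(* Defs.v *)
From mathcomp Require Import all_boot.
From mathcomp Require Import classical_sets.

Set Implicit Arguments.
Unset Strict Implicit.
Unset Printing Implicit Defensive.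

Local Open Scope classical_set_scope.

Definition sequent (S : Type) : Type := (seq S * seq S)%type.

(* Since S is an arbitrary set, there is no fixed syntax of schematic
   expressions: a schematic sequent over element metavariables E and list
   metavariables V is represented by the function sending each simultaneous
   substitution to the resulting sequent. *)
Record substitution (S E V : Type) := Substitution {
  elt_subst : E -> S;
  list_subst : V -> seq S }.

(* Each rule carries its own types of metavariables, so that a rule without
   element metavariables has instances even when S is empty.  The values of
   premiss outside premiss_index are irrelevant. *)
Record rule (S : Type) := Rule {
  elt_var : Type;
  list_var : Type;
  premiss_index : set nat;
  premiss : nat -> substitution S elt_var list_var -> sequent S;
  conclusion : substitution S elt_var list_var -> sequent S }.

Arguments premiss {S} r _ _.
Arguments conclusion {S} r _.

Definition calculus (S : Type) := set (rule S).

(* Existence of a well-founded proof tree.  A rule may have infinitely many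
   premisses; when the premiss sets are finite, these are the finite trees. *)
Inductive derivable (S : Type) (L : calculus S) : sequent S -> Prop :=
| derivable_rule (sigma : rule S)
    (theta : substitution S (elt_var sigma) (list_var sigma)) :
    L sigma ->
    (forall i, premiss_index sigma i -> derivable L (premiss sigma i theta)) ->
    derivable L (conclusion sigma theta).

Definition admissible (S : Type) (L : calculus S) (sigma : rule S) : Prop :=
  forall theta : substitution S (elt_var sigma) (list_var sigma),
    (forall i, premiss_index sigma i -> derivable L (premiss sigma i theta)) ->
    derivable L (conclusion sigma theta).

Definition calculus_le (S : Type) (L M : calculus S) : Prop :=
  forall sigma, L sigma -> admissible M sigma.

Definition translate_sequent (S : Type) (l r : seq S -> seq S)
    (s : sequent S) : sequent S := (l s.1, r s.2).

Definition translate_rule (S : Type) (l r : seq S -> seq S)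
    (sigma : rule S) : rule S :=
  @Rule S (elt_var sigma) (list_var sigma) (premiss_index sigma)
    (fun i theta => translate_sequent l r (premiss sigma i theta))
    (fun theta => translate_sequent l r (conclusion sigma theta)).

Definition translate_calculus (S : Type) (l r : seq S -> seq S)
    (M : calculus S) : calculus S := translate_rule l r @` M.

Definition sound_translation (S : Type) (l r : seq S -> seq S)
    (M L : calculus S) : Prop :=
  forall Gamma Delta : seq S,
    derivable M (Gamma, Delta) -> derivable L (l Gamma, r Delta).

Definition faithful_translation (S : Type) (l r : seq S -> seq S)
    (M L : calculus S) : Prop :=
  forall Gamma Delta : seq S,
    derivable L (l Gamma, r Delta) -> derivable M (Gamma, Delta).

(* Main.v *)
(** Translating every sequent of an M-derivation gives a derivation in the
    translated calculus, whence soundness. Conversely, an instance of a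
    translated rule is admissible in any K into which M translates soundly and
    faithfully: faithfulness pulls its premisses back to M, the original rule
    applies there, and soundness pushes the conclusion forward to K. For
    K = M this shows that G is below M as soon as L is. *)

Require Import Defs.
From mathcomp Require Import all_boot.
From mathcomp Require Import classical_sets.

Set Implicit Arguments.
Unset Strict Implicit.
Unset Printing Implicit Defensive.

Local Open Scope classical_set_scope.

(** Induction on the derivation: admissibility in [M] replaces each inference of [L]. *)
Lemma derivable_le (S : Type) (L M : calculus S) (s : sequent S) :
  calculus_le L M -> derivable L s -> derivable M s.
Proof. by move=> LM; elim=> sigma theta Lsigma _ IH; exact: LM IH. Qed.

Lemma calculus_sub_le (S : Type) (L M : calculus S) :
  L `<=` M -> calculus_le L M.
Proof. by move=> LM sigma Lsigma theta; apply: derivable_rule; apply: LM. Qed.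

Lemma derivable_translate (S : Type) (l r : seq S -> seq S)
    (M : calculus S) (s : sequent S) :
  derivable M s ->
  derivable (translate_calculus l r M) (translate_sequent l r s).
Proof.
elim=> sigma theta Msigma _ IH.
apply: (@derivable_rule _ _ (translate_rule l r sigma) theta) => //.
by exists sigma.
Qed.

Lemma translate_calculus_le (S : Type) (l r : seq S -> seq S)
    (M K : calculus S) :
  sound_translation l r M K -> faithful_translation l r M K ->
  calculus_le (translate_calculus l r M) K.
Proof.
move=> sound faithful _ [sigma Msigma <-] theta prem; apply: sound.
(* Soundness speaks of explicit pairs; the two projections fold back to the conclusion of
   [sigma]. *)
rewrite -surjective_pairing; apply: derivable_rule => // i /prem /faithful.
by rewrite -surjective_pairing.
Qed.

Lemma calculus_le_setU (S : Type) (L M K : calculus S) :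
  calculus_le L K -> calculus_le M K -> calculus_le (L `|` M) K.
Proof. by move=> LK MK sigma [/LK|/MK]. Qed.

Theorem theorem2p7 (S : Type) (L M : calculus S) (l r : seq S -> seq S)
  (hsound : sound_translation l r M M)
  (hfaithful : faithful_translation l r M M) :
  let G := L `|` translate_calculus l r M in
  (sound_translation l r M G /\
   (forall K : calculus S, calculus_le G K -> sound_translation l r M K)) /\
  ((forall K : calculus S, calculus_le K M -> faithful_translation l r M K) /\
   (calculus_le L M ->
    faithful_translation l r M L /\ faithful_translation l r M G)) /\
  (forall K : calculus S,
    calculus_le L K ->
    sound_translation l r M K -> faithful_translation l r M K ->
    calculus_le G K).
Proof.
move=> G.
have soundG K : calculus_le G K -> sound_translation l r M K.
  move=> GK Gamma Delta /(derivable_translate l r) dM.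
  (* From the translated calculus to [G] by inclusion, then on to [K]. *)
  apply: derivable_le GK _; apply: derivable_le dM.
  exact/calculus_sub_le/subsetUr.
have faithfulK K : calculus_le K M -> faithful_translation l r M K.
  by move=> KM Gamma Delta /(derivable_le KM)/hfaithful.
have leGK K : calculus_le L K -> sound_translation l r M K ->
    faithful_translation l r M K -> calculus_le G K.
  by move=> LK sK fK; apply: calculus_le_setU LK (translate_calculus_le sK fK).
do 2![split] => //; first exact/soundG/calculus_sub_le.
(* Here [leGK] is taken at [K := M], with [hsound] and [hfaithful]. *)
split=> // LM; split; apply: faithfulK => //; exact: leGK.
Qed.
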